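(* Let $S$ denote the Shrikhande graph. For a positive integer $n$, there exists an $S$-design of order $n$ if and only if $n \equiv 1 \pmod{96}$.
   Context: The Shrikhande graph $S$ is the Cayley graph on the group $\mathbb{Z}_4 \times \mathbb{Z}_4$ with connection set $\{\pm(1,0), \pm(0,1), \pm(1,1)\}$. It is a 6-regular graph on 16 vertices with 48 edges, and it is strongly regular with parameters $(16,6,2,2)$. For simple graphs $F$ and $G$, a $G$-decomposition of $F$ is a partition of the edge set of $F$ into classes, each of which is the edge set of a subgraph of $F$ isomorphic to $G$. A $G$-design of order $n$ is a $G$-decomposition of the complete graph $K_n$; for $n=1$, the empty decomposition counts as a $G$-design. *)

(* Defs.v *)
From mathcomp Require Import all_boot all_algebra.
Set Implicit Arguments. Unset Strict Implicit. Unset Printing Implicit Defensive.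
Import GRing.Theory.
Local Open Scope ring_scope.

Definition shrV : finType := ('Z_4 * 'Z_4)%type.

Definition shr_conn : seq ('Z_4 * 'Z_4) :=
  [:: (1, 0); (-1, 0); (0, 1); (0, -1); (1, 1); (-1, -1)].

Definition shr_adj (x y : shrV) : bool :=
  (y.1 - x.1, y.2 - x.2) \in shr_conn.

Definition Kn_edges (n : nat) : {set {set 'I_n}} :=
  [set e : {set 'I_n} | #|e| == 2%N].

Definition shr_copy_edges (n : nat) (f : shrV -> 'I_n) : {set {set 'I_n}} :=
  [set [set f p.1; f p.2] | p in [set p : shrV * shrV | shr_adj p.1 p.2]].

Definition is_shr_copy (n : nat) (B : {set {set 'I_n}}) : Prop :=
  exists f : shrV -> 'I_n, injective f /\ B = shr_copy_edges f.

Definition shr_design (n : nat) : Prop :=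
  exists P : {set {set {set 'I_n}}},
    partition P (Kn_edges n) /\ (forall B, B \in P -> is_shr_copy B).

(* Main.v *)
Require Import Defs.
From HB Require Import structures.
From mathcomp Require Import all_boot all_algebra.
From mathcomp Require Import zify ring.
From Stdlib Require List.

Set Implicit Arguments.
Unset Strict Implicit.
Unset Printing Implicit Defensive.

Import GRing.Theory.

(** Necessity: degrees give 6 | n - 1 and edges give 48 | n (n - 1) / 2, hence
    n is prime to 96 and 96 | n - 1.

    Sufficiency for n = 96 t + 1: for t = 1, 2, 3 there are difference families
    over F_97, F_193 and F_289.  The graph K_{4,4,4,4} is the union of two
    Shrikhande graphs, so every 4-GDD of type s^t can be inflated to a
    decomposition of the complete multipartite graph K_t[96] as soon as
    K_4[96/s] is decomposed; adding one point and filling the groups with designs of order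
    97 yields order 96 t + 1.  For 4 <= t < 20 such GDDs come from difference
    families over Z_m x Z_s, with or without a fixed group, m = t or t - 1.  For
    t >= 20 write t = k m + u with u <= m, k in {4, 5, 6} and m prime to
    2, ..., k - 1: inflate a transversal design TD(k + 1, m) with one group
    truncated to u points, whose blocks have size k or k + 1, and fill the groups
    with the designs of orders 96 m + 1 and 96 u + 1. *)

(** * Copies of the Shrikhande graph and necessity *)

(** An explicit enumeration, so that finite facts on the graph become boolean checks for
    [vm_compute]. *)
Definition shr_vertices : seq shrV :=
  [seq (inZp i, inZp j) | i <- iota 0 4, j <- iota 0 4].

Definition shr_darts : seq (shrV * shrV) :=
  [seq p <- [seq (u, v) | u <- shr_vertices, v <- shr_vertices]
     | shr_adj p.1 p.2].

Lemma mem_shr_vertices (v : shrV) : v \in shr_vertices.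
Proof.
case: v => a b; apply/allpairsP; exists (val a, val b).
by rewrite !mem_iota /= !ltn_ord; split => //; congr (_, _); rewrite valZpK.
Qed.

Lemma mem_shr_darts (p : shrV * shrV) : (p \in shr_darts) = shr_adj p.1 p.2.
Proof.
rewrite mem_filter; apply: andb_idr => _; case: p => u v.
by apply/allpairsP; exists (u, v); rewrite !mem_shr_vertices.
Qed.

Lemma shr_adj_sym (u v : shrV) : shr_adj u v = shr_adj v u.
Proof.
have /allP H : all (fun u => all (fun v => shr_adj u v == shr_adj v u)
  shr_vertices) shr_vertices by vm_compute.
by have /allP/(_ _ (mem_shr_vertices v))/eqP := H u (mem_shr_vertices u).
Qed.

Lemma shr_adj_irrefl (u : shrV) : shr_adj u u = false.
Proof.
have /allP H : all (fun u => ~~ shr_adj u u) shr_vertices by vm_compute.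
exact/negbTE/H/mem_shr_vertices.
Qed.

(** Strong regularity gives two such neighbours; one serves later to pass from injectivity on darts
    to injectivity on vertices. *)
Lemma shr_common_neighbour (u v : shrV) :
  u != v -> exists w, shr_adj u w /\ shr_adj v w.
Proof.
have /allP H : all (fun u => all (fun v => (u == v) || has (fun w =>
  shr_adj u w && shr_adj v w) shr_vertices) shr_vertices) shr_vertices.
  by vm_compute.
have /allP/(_ _ (mem_shr_vertices v)) := H u (mem_shr_vertices u).
by move=> /orP[/eqP-> /eqP//|/hasP[w _ /andP[uw vw]] _]; exists w.
Qed.

Lemma uniq_shr_darts : uniq shr_darts. Proof. by vm_compute. Qed.

Lemma card_shr_darts : #|[set p : shrV * shrV | shr_adj p.1 p.2]| = 96.
Proof.
rewrite cardsE -[RHS]/(size shr_darts) -(card_uniqP uniq_shr_darts).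
by apply: eq_card => p; rewrite mem_shr_darts.
Qed.

Lemma shr_degree (u : shrV) : #|[set v | shr_adj u v]| = 6.
Proof.
have /allP H : all (fun u => size [seq v <- shr_vertices | shr_adj u v] == 6)
  shr_vertices by vm_compute.
have /eqP <- := H u (mem_shr_vertices u).
have us : uniq [seq v <- shr_vertices | shr_adj u v].
  by apply: filter_uniq; vm_compute.
rewrite -(card_uniqP us) cardsE; apply: eq_card => v.
by rewrite mem_filter mem_shr_vertices andbT.
Qed.

Lemma card_shrV : #|shrV| = 16.
Proof. by rewrite card_prod !card_ord. Qed.

Lemma shr_copy_edgesP n (f : shrV -> 'I_n) (e : {set 'I_n}) :
  reflect (exists u v, shr_adj u v /\ e = [set f u; f v])
          (e \in shr_copy_edges f).
Proof.
apply: (iffP imsetP) => [[[u v]]|[u [v [uv ->]]]].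
  by rewrite inE /= => uv ->; exists u, v.
by exists (u, v); rewrite ?inE.
Qed.

Section CopyDegrees.
Variables (n : nat) (f : shrV -> 'I_n).
Hypothesis f_inj : injective f.

Lemma shr_copy_degree (u : shrV) :
  \sum_(e in shr_copy_edges f) (f u \in e) = 6.
Proof.
have -> : \sum_(e in shr_copy_edges f) (f u \in e) =
    #|[set [set f u; f v] | v in [set v | shr_adj u v]]|.
  rewrite -sum1_card big_mkcond [RHS]big_mkcond; apply: eq_bigr => e _.
  case: imsetP => [[v]|noe].
    rewrite inE => uv ->; rewrite !inE eqxx.
    by have -> : [set f u; f v] \in shr_copy_edges f
      by apply/shr_copy_edgesP; exists u, v.
  case: ifP => // /shr_copy_edgesP[a [b [ab e_ab]]]; rewrite e_ab !inE.
  case: eqP => [/f_inj ua|_] /=.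
    by case: noe; exists b; rewrite ?inE ua.
  case: eqP => [/f_inj ub|//].
  by case: noe; exists a; rewrite ?inE ub ?e_ab 1?setUC // shr_adj_sym.
rewrite card_in_imset ?shr_degree // => v w.
rewrite !inE => uv uw /setP/(_ (f v)); rewrite !inE eqxx orbT.
case: eqP => [/f_inj vu|_ /esym/eqP/f_inj//].
by rewrite vu shr_adj_irrefl in uv.
Qed.

Lemma shr_copy_degree0 (x : 'I_n) :
  x \notin codom f -> \sum_(e in shr_copy_edges f) (x \in e) = 0.
Proof.
move=> xf; apply: big1 => e /shr_copy_edgesP[u [v [_ ->]]].
rewrite !inE; case: eqP => [xu|_]; first by rewrite xu codom_f in xf.
by case: eqP => [xv|//]; rewrite xv codom_f in xf.
Qed.

(** Double counting of incidences: 16 vertices of degree 6 give 96, twice the number of edges. *)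
Lemma card_shr_copy_edges : #|shr_copy_edges f| = 48.
Proof.
apply/eqP; rewrite -(eqn_pmul2r (isT : 0 < 2)).
have <- : \sum_(x : 'I_n) \sum_(e in shr_copy_edges f) (x \in e) =
          #|shr_copy_edges f| * 2.
  rewrite exchange_big -sum_nat_const /=.
  apply: eq_bigr => e /shr_copy_edgesP[u [v [uv ->]]].
  have -> : \sum_(x : 'I_n) (x \in [set f u; f v] : nat) = #|[set f u; f v]|.
    by rewrite -sum1_card [RHS]big_mkcond; apply: eq_bigr => x _; case: ifP.
  rewrite cards2 (inj_eq f_inj); case: eqP => // uv_eq.
  by rewrite uv_eq shr_adj_irrefl in uv.
rewrite (bigID (mem (codom f))) /= [X in _ + X]big1 => [|x]; last first.
  exact: shr_copy_degree0.
rewrite (eq_bigr (fun=> 6)) => [|x /codomP[u ->]]; last exact: shr_copy_degree.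
by rewrite sum_nat_const card_codom // card_shrV.
Qed.

End CopyDegrees.

Lemma sum_Kn_degree n (x : 'I_n) : \sum_(e in Kn_edges n) (x \in e) = n.-1.
Proof.
have -> : \sum_(e in Kn_edges n) (x \in e) = #|[set [set x; y] | y in [set~ x]]|.
  rewrite -sum1_card big_mkcond [RHS]big_mkcond; apply: eq_bigr => e _.
  case: imsetP => [[y]|noe].
    rewrite inE in_set1 => yx ->.
    by rewrite !inE eqxx cards2 [x == y]eq_sym yx.
  rewrite inE; case: ifP => // /cards2P[a [b [ab e_ab]]]; rewrite e_ab !inE.
  case: eqP => [xa|_] /=.
    by case: noe; exists b; rewrite ?inE ?in_set1 xa // eq_sym.
  case: eqP => [xb|//].
  by case: noe; exists a; rewrite ?inE ?in_set1 xb // e_ab setUC.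
rewrite card_in_imset; first by rewrite cardsC1 card_ord.
move=> y z; rewrite !inE => yx zx /setP/(_ y); rewrite !inE eqxx orbT.
by rewrite (negbTE yx) /= => /esym/eqP.
Qed.

Lemma card_Kn_edges n : #|Kn_edges n| = 'C(n, 2).
Proof. by rewrite card_draws card_ord. Qed.

Lemma shr_design_necessary n : 0 < n -> shr_design n -> n = 1 %[mod 96].
Proof.
move=> n0 [P [partP copyP]].
have d6 : 6 %| n.-1.
  rewrite -(sum_Kn_degree (Ordinal n0)) (set_partition_big _ partP) /=.
  apply: (big_ind (fun s => 6 %| s)) => // [a b|B /copyP[f [f_inj ->]]].
    exact: dvdn_add.
  (* The chosen point has degree 6 in a copy through it and degree 0 in any other. *)
  case xf : (Ordinal n0 \in codom f).
    by have /codomP[u ->] := xf; rewrite shr_copy_degree.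
  by rewrite shr_copy_degree0 // xf.
have d48 : 48 %| 'C(n, 2).
  rewrite -card_Kn_edges (card_partition partP).
  apply: (big_ind (fun s => 48 %| s)) => // [a b|B /copyP[f [f_inj ->]]].
    exact: dvdn_add.
  by rewrite card_shr_copy_edges.
have d96 : 96 %| n * n.-1.
  by have := mul_bin_diag n 1; rewrite bin1 => ->; apply: (@dvdn_mul 2 48).
apply/eqP; rewrite eqn_mod_dvd // subn1.
rewrite Gauss_dvdr // in d96.
(* As 6 divides [n.-1], neither 2 nor 3 divides [n]. *)
rewrite (_ : 96 = 2 ^ 5 * 3) // coprimeMl coprime_pexpl //.
by rewrite !prime_coprime //; lia.
Qed.

(** * Coverings by darts *)

(** Labellings are plain functions, without decidable equality; hence [List.In] rather than
    [\in]. *)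
Definition dart_in (V : Type) (L : seq (shrV -> V)) (x y : V) : Prop :=
  exists f u v, [/\ List.In f L, shr_adj u v, f u = x & f v = y].

Lemma dart_in_map (V V' : Type) (g : V -> V') L x y :
  dart_in L x y -> dart_in [seq g \o f | f <- L] (g x) (g y).
Proof.
case=> f [u [v [fL uv <- <-]]]; exists (g \o f), u, v; split=> //.
exact: List.in_map.
Qed.

Lemma dart_in_catl (V : Type) (L L' : seq (shrV -> V)) x y :
  dart_in L x y -> dart_in (L ++ L') x y.
Proof.
case=> f [u [v [fL uv fu fv]]]; exists f, u, v; split=> //.
by apply/List.in_app_iff; left.
Qed.

Lemma dart_in_catr (V : Type) (L L' : seq (shrV -> V)) x y :
  dart_in L' x y -> dart_in (L ++ L') x y.
Proof.
case=> f [u [v [fL uv fu fv]]]; exists f, u, v; split=> //.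
by apply/List.in_app_iff; right.
Qed.

Lemma dart_in_flatten (I : eqType) (V : Type) (F : I -> seq (shrV -> V)) s i x y :
  i \in s -> dart_in (F i) x y -> dart_in (flatten [seq F j | j <- s]) x y.
Proof.
elim: s => // j s IHs; rewrite inE => /orP[/eqP<-|/IHs{}IHs] /= xy.
  exact: dart_in_catl.
exact/dart_in_catr/IHs.
Qed.

Lemma size_flatten_const (I T : Type) (F : I -> seq T) s k :
  (forall i, size (F i) = k) -> size (flatten [seq F j | j <- s]) = size s * k.
Proof. by move=> Fk; elim: s => //= i s IHs; rewrite size_cat Fk IHs mulSn. Qed.

(* There are as many darts in the copies of [L] as ordered pairs to cover, so a
   covering is automatically exact. *)
Definition complete_dec (V : finType) : Prop :=
  exists2 L : seq (shrV -> V),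
    (forall x y, x != y -> dart_in L x y)
    & size L * 96 = #|V| * #|V|.-1.

(* Decomposition of the complete multipartite graph with parts [{u} * W]. *)
Definition multi_dec (U W : finType) : Prop :=
  exists2 L : seq (shrV -> U * W),
    (forall x y, x.1 != y.1 -> dart_in L x y)
    & size L * 96 = #|U| * #|U|.-1 * #|W| ^ 2.

Lemma bij_of_card (V V' : finType) : #|V| = #|V'| ->
  exists (g : V -> V') (h : V' -> V), cancel h g.
Proof.
move=> VV'; exists (fun x => enum_val (cast_ord VV' (enum_rank x))).
exists (fun y => enum_val (cast_ord (esym VV') (enum_rank y))) => y.
by rewrite enum_valK cast_ordKV enum_rankK.
Qed.

Lemma complete_dec_card (V V' : finType) :
  #|V| = #|V'| -> complete_dec V -> complete_dec V'.
Proof.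
move=> VV' [L Lcov Lsize]; have [g [h hK]] := bij_of_card VV'.
exists [seq g \o f | f <- L] => [x y xy|]; last by rewrite size_map Lsize VV'.
rewrite -(hK x) -(hK y); apply/dart_in_map/Lcov.
by rewrite (inj_eq (can_inj hK)).
Qed.

Lemma multi_dec_card (U W U' W' : finType) :
  #|U| = #|U'| -> #|W| = #|W'| -> multi_dec U W -> multi_dec U' W'.
Proof.
move=> UU' WW' [L Lcov Lsize].
have [g [h hK]] := bij_of_card UU'; have [g' [h' hK']] := bij_of_card WW'.
pose G p := (g p.1, g' p.2).
exists [seq G \o f | f <- L] => [[x w] [y z] /= xy|]; last first.
  by rewrite size_map Lsize UU' WW'.
rewrite -(hK x) -(hK y) -(hK' w) -(hK' z).
apply: (dart_in_map G (x := (_, _)) (y := (_, _))).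
by apply: Lcov; rewrite /= (inj_eq (can_inj hK)).
Qed.

(** The darts of all copies and the ordered pairs of distinct points are equinumerous, and [Phi]
    reaches every such pair; so [Phi] is a bijection between them. This makes every labelling
    injective and the copies edge-disjoint. *)
Lemma complete_dec_shr_design (V : finType) : complete_dec V -> shr_design #|V|.
Proof.
move=> /(@complete_dec_card _ 'I_#|V|); rewrite card_ord => /(_ erefl).
set n := #|V| => -[L Lcov]; rewrite card_ord => Lsize.
pose N := size L.
(* Without points there is no edge, and no default value [x0] for [nth]. *)
case: (posnP n) => [n0|n_gt0].
  exists set0; split=> [|B]; last by rewrite inE.
  apply/and3P; split; rewrite ?inE //; last first.
    by apply/trivIsetP => A B; rewrite inE.
  rewrite /cover big_set0 eq_sym -subset0; apply/subsetP => e.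
  rewrite inE => /cards2P[a _]; have := ltn_ord a; lia.
pose x0 : 'I_n := Ordinal n_gt0.
pose F (i : 'I_N) : shrV -> 'I_n := nth (fun=> x0) L i.
pose A := setX [set: 'I_N] [set p : shrV * shrV | shr_adj p.1 p.2].
pose O := [set p : 'I_n * 'I_n | p.1 != p.2].
pose Phi (a : 'I_N * (shrV * shrV)) := (F a.1 a.2.1, F a.1 a.2.2).
have cardA : #|A| = N * 96.
  by rewrite cardsX cardsT card_ord card_shr_darts.
have cardO : #|O| = n * n.-1.
  have cardE : #|[set p : 'I_n * 'I_n | p.1 == p.2]| = n.
    have -> : [set p : 'I_n * 'I_n | p.1 == p.2] = [set (x, x) | x : 'I_n].
      apply/setP => -[x y]; rewrite inE /=; apply/eqP/imsetP => [->|[z _ [-> ->]]] //.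
      by exists y.
    by rewrite card_imset ?card_ord // => x y [].
  have := cardsC [set p : 'I_n * 'I_n | p.1 == p.2].
  rewrite cardE card_prod card_ord.
  have -> : ~: [set p : 'I_n * 'I_n | p.1 == p.2] = O by apply/setP => p; rewrite !inE.
  by move=> eq_nn; rewrite -subn1 mulnBr muln1 -eq_nn addKn.
have subO : O \subset Phi @: A.
  apply/subsetP => -[x y]; rewrite inE /= => /Lcov[f [u [v [fL uv fu fv]]]].
  have [i [ltiN fi]] := List.In_nth L f (fun=> x0) fL.
  have ltiN' : i < N by apply/ltP.
  have Fi : F (Ordinal ltiN') = f.
    by rewrite -fi /F /=; elim: (L) i {ltiN fi ltiN'} => [|g s IHs] [|i] //=.
  apply/imsetP; exists (Ordinal ltiN', (u, v)); first by rewrite !inE.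
  by rewrite /Phi /= Fi fu fv.
have le1 : #|O| <= #|Phi @: A| by apply: subset_leq_card.
have le2 : #|Phi @: A| <= #|A| by apply: leq_imset_card.
have eqAO : #|A| = #|O| by rewrite cardA cardO Lsize.
have Phi_inj : {in A &, injective Phi}.
  by apply/imset_injP; rewrite eqn_leq le2 eqAO le1.
have eqO : O = Phi @: A by apply/eqP; rewrite eqEcard subO -eqAO le2.
have Adart i u v : shr_adj u v -> (i, (u, v)) \in A by move=> uv; rewrite !inE.
have F_neq i u v : shr_adj u v -> F i u != F i v.
  move=> uv; have : Phi (i, (u, v)) \in O by rewrite eqO imset_f ?Adart.
  by rewrite inE.
(* If [u] and [v] had the same image, their darts to a common neighbour would have the same image
   under [Phi]. *)
have F_inj i : injective (F i).
  move=> u v Fuv; case: (eqVneq u v) => // /shr_common_neighbour[w [uw vw]].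
  by have [] : (i, (u, w)) = (i, (v, w))
    by apply: Phi_inj; rewrite ?Adart // /Phi /= Fuv.
(* A shared edge comes from a dart in each copy, with equal or opposite orientations; after
   reversing one dart if necessary, injectivity of [Phi] identifies the copies. *)
have blockI i j e :
    e \in shr_copy_edges (F i) -> e \in shr_copy_edges (F j) -> i = j.
  move=> /shr_copy_edgesP[u [v [uv ->]]] /shr_copy_edgesP[a [b [ab eq_e]]].
  have : (F i u == F j a) && (F i v == F j b) || (F i u == F j b) && (F i v == F j a).
    have := F_neq i u v uv.
    have : F i u \in [set F j a; F j b] by rewrite -eq_e !inE eqxx.
    have : F i v \in [set F j a; F j b] by rewrite -eq_e !inE eqxx orbT.
    by rewrite !inE => /orP[]/eqP-> /orP[]/eqP->; rewrite ?eqxx ?orbT.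
  have ba : shr_adj b a by rewrite shr_adj_sym.
  case/orP => /andP[/eqP e1 /eqP e2].
    by have [] : (i, (u, v)) = (j, (a, b))
      by apply: Phi_inj; rewrite ?Adart // /Phi /= e1 e2.
  by have [] : (i, (u, v)) = (j, (b, a))
    by apply: Phi_inj; rewrite ?Adart // /Phi /= e1 e2.
exists [set shr_copy_edges (F i) | i : 'I_N]; split; last first.
  by move=> B /imsetP[i _ ->]; exists (F i).
apply/and3P; split.
- apply/eqP/setP => e; apply/bigcupP/idP => [[B /imsetP[i _ ->]]|].
    by move=> /shr_copy_edgesP[u [v [uv ->]]]; rewrite inE cards2 F_neq.
  rewrite inE => /cards2P[x [y [xy ->]]].
  have : (x, y) \in O by rewrite inE.
  rewrite eqO => /imsetP[[i [u v]]]; rewrite !inE /= => uv [-> ->].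
  by exists (shr_copy_edges (F i)); [exact: imset_f | apply/shr_copy_edgesP; exists u, v].
- apply/trivIsetP => B C /imsetP[i _ ->] /imsetP[j _ ->] neqBC.
  apply/pred0P => e /=; apply/negP => /andP[ei ej]; move/eqP: neqBC; apply.
  by rewrite (blockI i j e).
(* No block is empty: each contains the image of the edge from (0, 0) to (1, 0). *)
- apply/negP => /imsetP[i _ /setP/(_ [set F i (0%R, 0%R); F i (1%R, 0%R)])].
  rewrite inE => /esym/negP[]; apply/shr_copy_edgesP.
  by exists (0%R, 0%R), (1%R, 0%R).
Qed.

(** * Difference families and group divisible designs *)

(** Base blocks are given below as lists of 16 labels, read row by row. *)
Definition label (T : Type) (x0 : T) (l : seq T) (v : shrV) : T :=
  nth x0 l (4 * v.1 + v.2).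

Definition ord_pts (p : nat) : seq 'I_p.+1 := [seq inZp i | i <- iota 0 p.+1].

Lemma mem_ord_pts p (x : 'I_p.+1) : x \in ord_pts p.
Proof.
by apply/mapP; exists (val x); rewrite ?mem_iota ?valZpK //= ltn_ord.
Qed.

Lemma mem_In (T : eqType) (x : T) s : x \in s -> List.In x s.
Proof. by elim: s => //= y s IHs; rewrite inE => /orP[/eqP->|/IHs]; auto. Qed.

(* Naming [ds] lets [vm_compute] evaluate the list of covered elements once. *)
Definition all_covered (T : eqType) (trivial : pred T) (ds pts : seq T) : bool :=
  all (fun d => trivial d || (d \in ds)) pts.

Lemma all_coveredP (T : eqType) (trivial : pred T) (ds pts : seq T) d :
  all_covered trivial ds pts -> d \in pts -> ~~ trivial d -> d \in ds.
Proof. by move=> /allP/(_ d) cov /cov /orP[->|]. Qed.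

(** The base blocks are developed under all translations: a dart [(u, v)] with difference [y - x]
    covers [(x, y)] in the translate that moves the label of [u] to [x]. *)
Lemma complete_dec_difference_family (V : finZmodType) (pts : seq V) (Ls : seq (seq V)) :
  (forall x, x \in pts) ->
  all_covered (pred1 0%R)
    [seq (label 0 l p.2 - label 0 l p.1)%R | l <- Ls, p <- shr_darts] pts ->
  size Ls * 96 = #|V|.-1 -> complete_dec V.
Proof.
move=> ptsP cov Lsize; pose Bs := [seq label 0%R l | l <- Ls].
exists (flatten [seq [seq (+%R^~ z) \o f | f <- Bs] | z <- enum V]); last first.
  rewrite (@size_flatten_const _ _ _ _ (size Ls)) => [|z]; last by rewrite !size_map.
  by rewrite -cardE -Lsize mulnA.
move=> x y xy; have yx0 : ~~ pred1 0%R (y - x)%R by rewrite /= subr_eq0 eq_sym.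
have /allpairsP[[l [u v]] /= [lL]] := all_coveredP cov (ptsP _) yx0.
rewrite mem_shr_darts /= => uv yx.
apply: (@dart_in_flatten _ _ _ _ (x - label 0 l u)%R); first by rewrite mem_enum.
set z := (x - _)%R; have -> : y = (label 0 l v + z)%R.
  by rewrite /z addrCA -yx addrC subrK.
have {1}-> : x = (label 0 l u + z)%R by rewrite /z addrC subrK.
apply: (dart_in_map (+%R^~ z)); exists (label 0%R l), u, v; split=> //.
exact/List.in_map/mem_In.
Qed.

(** The check runs on pairs of natural numbers, free of the proofs carried by ordinals; [inord]
    transfers the result. *)
Lemma multi_dec_check (p q : nat) (Ls : seq (seq (nat * nat))) :
  all_covered (fun d => d.1.1 == d.2.1)
    [seq (label (0, 0) l e.1, label (0, 0) l e.2) | l <- Ls, e <- shr_darts]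
    [seq (x, y) | x <- [seq (i, j) | i <- iota 0 p.+1, j <- iota 0 q.+1],
                  y <- [seq (i, j) | i <- iota 0 p.+1, j <- iota 0 q.+1]] ->
  size Ls * 96 = p.+1 * p * q.+1 ^ 2 -> multi_dec 'I_p.+1 'I_q.+1.
Proof.
move=> cov Lsize.
pose g (x : nat * nat) : 'I_p.+1 * 'I_q.+1 := (inord x.1, inord x.2).
exists [seq g \o f | f <- [seq label (0, 0) l | l <- Ls]]; last first.
  by rewrite !size_map Lsize !card_ord.
move=> [a b] [c d] /= ac.
have gE (x : 'I_p.+1) (y : 'I_q.+1) : (x, y) = g (val x, val y).
  by rewrite /g /= !inord_val.
have ptP (x : 'I_p.+1) (y : 'I_q.+1) :
    (val x, val y) \in [seq (i, j) | i <- iota 0 p.+1, j <- iota 0 q.+1].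
  by apply/allpairsP; exists (val x, val y); rewrite !mem_iota /= !ltn_ord.
rewrite !gE; apply: dart_in_map.
have pt_in : ((val a, val b), (val c, val d)) \in [seq (x, y) |
      x <- [seq (i, j) | i <- iota 0 p.+1, j <- iota 0 q.+1],
      y <- [seq (i, j) | i <- iota 0 p.+1, j <- iota 0 q.+1]].
  by apply/allpairsP; exists ((val a, val b), (val c, val d)); rewrite !ptP.
have /allpairsP[[l [u v]] /= [lL]] := all_coveredP cov pt_in ac.
rewrite mem_shr_darts /= => uv [-> ->].
by exists (label (0, 0) l), u, v; split=> //; apply/List.in_map/mem_In.
Qed.

(* A 4-GDD with groups [{u} * S]. *)
Definition gdd4 (U S : finType) : Prop :=
  exists2 Bs : seq ('I_4 -> U * S),
    (forall x y, x.1 != y.1 ->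
       exists B a b, [/\ List.In B Bs, B a = x & B b = y])
    & size Bs * 12 = #|U| * #|U|.-1 * #|S| ^ 2.

(** Wilson's inflation: every point becomes a copy of [W], and every block a decomposed complete
    4-partite graph with parts [W]. *)
Lemma gdd4_multi_dec (U S W : finType) :
  gdd4 U S -> multi_dec 'I_4 W -> multi_dec U (S * W)%type.
Proof.
move=> [Bs Bcov Bsize] [L Lcov Lsize]; rewrite card_ord in Lsize.
pose G (B : 'I_4 -> U * S) (x : 'I_4 * W) := ((B x.1).1, ((B x.1).2, x.2)).
exists (flatten [seq [seq G B \o h | h <- L] | B <- Bs]) => [x y|]; last first.
  rewrite (@size_flatten_const _ _ _ _ (size L)) => [|B]; last by rewrite size_map.
  by rewrite card_prod expnMn [RHS]mulnA -Bsize -mulnA Lsize !mulnA.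
case: x y => [u [s w]] [u' [s' w']] /= uu'.
have [B [a [b [BBs Ba Bb]]]] := Bcov (u, s) (u', s') uu'.
have ab : a != b by apply: contraNneq uu' => ab; rewrite ab Bb in Ba; case: Ba => ->.
have -> : (u, (s, w)) = G B (a, w) by rewrite /G /= Ba.
have -> : (u', (s', w')) = G B (b, w') by rewrite /G /= Bb.
have [f [v [v' [fL vv' fv fv']]]] := Lcov (a, w) (b, w') ab.
exists (G B \o f), v, v'; split=> //=; rewrite ?fv ?fv' //.
(* Blocks are functions, whereas [dart_in_flatten] indexes by an [eqType]; hence this direct
   induction. *)
elim: Bs BBs {Bcov Bsize} => //= B' Bs IHs [->|/IHs inBs]; apply/List.in_app_iff.
  by left; apply: (List.in_map (fun h => G B \o h)).
by right.
Qed.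

(** A transversal design TD(4, q + 1) written as words of length 4: symbol [b] at position [a] is
    the point [(a, b)]. *)
Lemma transversal_gdd4 (q : nat) (Bs : seq (seq nat)) :
  all (fun d => (d.1.1 == d.2.1) || has (fun B =>
      (nth 0 B d.1.1 == d.1.2) && (nth 0 B d.2.1 == d.2.2)) Bs)
    [seq (x, y) | x <- [seq (i, j) | i <- iota 0 4, j <- iota 0 q.+1],
                  y <- [seq (i, j) | i <- iota 0 4, j <- iota 0 q.+1]] ->
  size Bs = q.+1 ^ 2 -> gdd4 'I_4 'I_q.+1.
Proof.
move=> /allP cov Bsize.
pose F (B : seq nat) (a : 'I_4) : 'I_4 * 'I_q.+1 := (a, inord (nth 0 B a)).
exists [seq F B | B <- Bs]; last by rewrite size_map Bsize !card_ord; lia.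
move=> [a b] [c d] /= ac.
have ptP (x : 'I_4) (y : 'I_q.+1) :
    (val x, val y) \in [seq (i, j) | i <- iota 0 4, j <- iota 0 q.+1].
  by apply/allpairsP; exists (val x, val y); rewrite !mem_iota /= !ltn_ord.
have /cov/orP[/eqP/=/val_inj ac'|/hasP[B BBs /= /andP[/eqP Ba /eqP Bc]]] :
    ((val a, val b), (val c, val d)) \in [seq (x, y) |
      x <- [seq (i, j) | i <- iota 0 4, j <- iota 0 q.+1],
      y <- [seq (i, j) | i <- iota 0 4, j <- iota 0 q.+1]].
- by apply/allpairsP; exists ((val a, val b), (val c, val d)); rewrite !ptP.
- by rewrite ac' eqxx in ac.
exists (F B), a, c; split; first exact/List.in_map/mem_In.
- by rewrite /F Ba inord_val.
- by rewrite /F Bc inord_val.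
Qed.

Lemma In_allpairs (A B T : Type) (f : A -> B -> T) (s : seq A) (t : seq B) x y :
  List.In x s -> List.In y t -> List.In (f x y) [seq f a b | a <- s, b <- t].
Proof.
elim: s => //= a s IHs xs yt; apply/List.in_app_iff.
by case: xs => [->|/IHs]; [left; apply: List.in_map | right; auto].
Qed.

(** * Group divisible designs from difference families, with or without a fixed group *)

Section DifferenceGDD.
Variables (U S : finZmodType).
Implicit Types (Bs Is : seq (seq (U * S))) (pts : seq (U * S)).

Definition block_diffs (k : nat) Bs : seq (U * S) :=
  [seq (nth 0 B e.2 - nth 0 B e.1)%R
     | B <- Bs, e <- [seq (a, b) | a <- iota 0 k, b <- iota 0 k]].

Lemma block_diffsP k Bs d : d \in block_diffs k Bs ->
  exists B a b, [/\ B \in Bs, a < k, b < k & d = (nth 0 B b - nth 0 B a)%R].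
Proof.
move=> /allpairsP[[B e] /= [BBs /allpairsP[[a b] /= []]]].
by rewrite !mem_iota !add0n /= => ak bk -> ->; exists B, a, b.
Qed.

(** Blocks are developed over [U * S]; a difference with first component zero stays inside a group,
    so all others must occur. *)
Lemma gdd4_difference pts Bs : (forall x, x \in pts) ->
  all_covered (fun d => d.1 == 0%R) (block_diffs 4 Bs) pts ->
  size Bs * 12 = #|U|.-1 * #|S| -> gdd4 U S.
Proof.
move=> ptsP cov Bsize.
pose F B (z : U * S) (a : 'I_4) := (nth 0 B a + z)%R.
exists [seq F B z | B <- Bs, z <- enum {: U * S}]; last first.
  rewrite size_allpairs -cardE card_prod mulnAC Bsize; ring.
move=> x y xy; have := all_coveredP cov (ptsP (y - x)%R).
rewrite /= subr_eq0 eq_sym => /(_ xy) /block_diffsP[B [a [b [BBs a4 b4 yx]]]].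
pose z := (x - nth 0 B a)%R.
exists (F B z), (Ordinal a4), (Ordinal b4); split.
- by apply: In_allpairs; apply: mem_In; rewrite // mem_enum.
- by rewrite /F /z /= addrC subrK.
- by rewrite /F /z /= addrCA -yx addrC subrK.
Qed.

(** The group indexed by [None] is fixed by [U] and translated by [S]. Each triple of [Is] is
    completed by the point 0 of that group; its pairs with the other groups are covered because the
    second components in the triples run through [S]. *)
Lemma gdd4_difference_infty pts (ptsS : seq S) Bs Is :
  (forall x, x \in pts) -> (forall s, s \in ptsS) ->
  all_covered (fun d => d.1 == 0%R) (block_diffs 4 Bs ++ block_diffs 3 Is) pts ->
  all_covered pred0 [seq (nth 0%R J a).2 | J <- Is, a <- iota 0 3] ptsS ->
  (size Bs + size Is) * 12 = #|U|.+1 * #|S| -> gdd4 (option U) S.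
Proof.
move=> ptsP ptsSP cov infcov Bsize.
pose pt (x : U * S) := (Some x.1, x.2).
pose F B (z : U * S) (a : 'I_4) := pt (nth 0 B a + z)%R.
pose F' J (z : U * S) (a : 'I_4) :=
  if a < 3 then pt (nth 0 J a + z)%R else (None, z.2).
pose L := [seq F B z | B <- Bs, z <- enum {: U * S}].
pose L' := [seq F' J z | J <- Is, z <- enum {: U * S}].
have inL B z : B \in Bs -> List.In (F B z) (L ++ L').
  move=> BBs; apply/List.in_app_iff; left.
  by apply: In_allpairs; apply: mem_In; rewrite // mem_enum.
have inL' J z : J \in Is -> List.In (F' J z) (L ++ L').
  move=> JJs; apply/List.in_app_iff; right.
  by apply: In_allpairs; apply: mem_In; rewrite // mem_enum.
exists (L ++ L'); last first.
  rewrite size_cat !size_allpairs -cardE -mulnDl card_prod mulnAC Bsize.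
  by rewrite card_option /=; ring.
(* An entry with second component [s - k], translated by [k], falls on [s], while the added point
   falls on [k]. *)
have infP (u : U) (s k : S) : exists J z a, [/\ J \in Is, a < 3,
    pt (nth 0 J a + z)%R = (Some u, s) & z.2 = k].
  have /allpairsP[[J a] []] := all_coveredP infcov (ptsSP (s - k)%R) isT.
  rewrite mem_iota => JJs a3 sk; exists J, (u - (nth 0 J a).1, k)%R, a.
  by split=> //; rewrite /pt /= -sk subrK addrC subrK.
move=> [[u|] s] [[u'|] s'] //= uu'.
- have u'u : u' != u by apply: contraNneq uu' => ->.
  have := all_coveredP cov (ptsP ((u', s') - (u, s))%R).
  rewrite /= subr_eq0 mem_cat => /(_ u'u) /orP[].
    move=> /block_diffsP[B [a [b [BBs a4 b4 yx]]]].
    pose z := ((u, s) - nth 0 B a)%R.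
    exists (F B z), (Ordinal a4), (Ordinal b4); split; first exact: inL.
      by rewrite /F /z /= addrC subrK.
    by rewrite /F /z /= addrCA -yx addrC subrK.
  move=> /block_diffsP[J [a [b [JJs a3 b3 yx]]]].
  pose z := ((u, s) - nth 0 J a)%R.
  exists (F' J z), (Ordinal (ltnW a3 : a < 4)), (Ordinal (ltnW b3 : b < 4)).
  split; first exact: inL'.
    by rewrite /F' /z /= a3 addrC subrK.
  by rewrite /F' /z /= b3 addrCA -yx addrC subrK.
- have [J [z [a [JJs a3 zu zk]]]] := infP u s s'.
  exists (F' J z), (Ordinal (ltnW a3 : a < 4)), ord_max.
  by split; [exact: inL' | rewrite /F' /= a3 | rewrite /F' /= zk].
- have [J [z [a [JJs a3 zu zk]]]] := infP u' s' s.
  exists (F' J z), ord_max, (Ordinal (ltnW a3 : a < 4)).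
  by split; [exact: inL' | rewrite /F' /= zk | rewrite /F' /= a3].
Qed.

End DifferenceGDD.

(** The groups share the new point [None]; a design on each group with that point covers the pairs
    missing from the multipartite graph. *)
Lemma multi_dec_complete_dec (U W : finType) :
  multi_dec U W -> complete_dec (option W) -> complete_dec (option (U * W)).
Proof.
move=> [L Lcov Lsize] [L1 L1cov]; rewrite card_option /= => L1size.
pose G u := omap (fun w : W => (u : U, w)).
pose L2 := flatten [seq [seq G u \o f | f <- L1] | u <- enum U].
have L2cov u (x y : option W) : x != y -> dart_in L2 (G u x) (G u y).
  move=> xy; apply: (@dart_in_flatten _ _ _ _ u); first by rewrite mem_enum.
  exact/dart_in_map/L1cov.
exists ([seq Some \o f | f <- L] ++ L2); last first.
  rewrite size_cat (@size_flatten_const _ _ _ _ (size L1)) => [|u]; last first.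
    by rewrite size_map.
  rewrite size_map -cardE card_option card_prod /= mulnDl Lsize.
  rewrite -[_ * size L1 * _]mulnA L1size.
  by case: #|U| => [|u] /=; [rewrite !mul0n | ring].
move=> [[u w]|] [[u' w']|] // xy.
- case: (eqVneq u u') => [uu'|uu']; last by apply/dart_in_catl/dart_in_map/Lcov.
  rewrite -uu' in xy *; apply: dart_in_catr.
  apply: (L2cov u (Some w) (Some w')).
  by apply: contraNneq xy => -[->].
- exact/dart_in_catr/(L2cov u (Some w) None).
- exact/dart_in_catr/(L2cov u' None (Some w')).
Qed.

(** * Inflation of truncated transversal designs over the integers modulo [m] *)

Section TruncatedTransversal.
Variables (k p u : nat) (W : finType).
Let m := p.+2.
Hypothesis co_m : forall i, 0 < i < k -> coprime m i.
Hypothesis um : u <= m.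

(** Up to sign the difference is an integer between 1 and [k - 1], hence prime to [m]. This yields
    the line through two points of distinct groups. *)
Lemma natr_sub_unit (i j : 'I_k) : i != j ->
  ((j : nat)%:R - (i : nat)%:R : 'I_p.+2)%R \is a GRing.unit.
Proof.
wlog ij : i j / i < j => [wlog_ij|_].
  case: (ltngtP i j) => [/wlog_ij//|ji|/val_inj->]; last by rewrite eqxx.
  by rewrite eq_sym => /(wlog_ij _ _ ji); rewrite -unitrN opprB.
rewrite -natrB ?(ltnW ij) // (@unitZpE p.+2) // co_m //.
by have := ltn_ord j; lia.
Qed.

(* The blocks are the lines [y = a + j b] of the transversal design, extended by
   the point [b] of the last group when [b < u]. *)
Lemma truncated_transversal_complete_dec :
  multi_dec 'I_k W -> multi_dec (option 'I_k) W ->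
  complete_dec (option ('I_m * W)) -> complete_dec (option ('I_u * W)) ->
  complete_dec (option (('I_k * 'I_m + 'I_u) * W)).
Proof.
move=> [Lk Lkcov Lksize] [Lk1 Lk1cov Lk1size] [Lm Lmcov Lmsize].
move=> [Lu Lucov Lusize].
rewrite ?card_option ?card_prod ?card_ord /= in Lksize Lk1size Lmsize Lusize.
pose P := ('I_k * 'I_m + 'I_u)%type.
pose line (a b : 'I_p.+2) (j : 'I_k) : P := inl (j, (a + (j : nat)%:R * b)%R).
(* [G1] inflates the lines of slope below [u] with their extra point, and [G2] the lines of slope
   [u + z.2], which keep [k] points. [G3] and [G4] fill the groups together with the common
   point. *)
pose G1 (z : 'I_m * 'I_u) (x : option 'I_k * W) : option (P * W) :=
  Some (if x.1 is Some j then line z.1 (z.2 : nat)%:R%R j else inr z.2, x.2).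
pose G2 (z : 'I_m * 'I_(m - u)) (x : 'I_k * W) : option (P * W) :=
  Some (line z.1 (u + z.2)%:R%R x.1, x.2).
pose G3 j := omap (fun y : 'I_m * W => (inl (j : 'I_k, y.1) : P, y.2)).
pose G4 := omap (fun y : 'I_u * W => (inr y.1 : P, y.2)).
pose L1 := flatten [seq [seq G1 z \o h | h <- Lk1] | z <- enum {: 'I_m * 'I_u}].
pose L2 := flatten [seq [seq G2 z \o h | h <- Lk]
                      | z <- enum {: 'I_m * 'I_(m - u)}].
pose L3 := flatten [seq [seq G3 j \o h | h <- Lm] | j <- enum 'I_k].
pose L4 := [seq G4 \o h | h <- Lu].
exists (L1 ++ L2 ++ L3 ++ L4); last first.
  have -> : #|{: option (P * W)}| = ((k * m + u) * #|W|).+1.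
    by rewrite card_option card_prod card_sum card_prod !card_ord.
  rewrite !size_cat (@size_flatten_const _ _ _ _ (size Lk1)); last first.
    by move=> z; rewrite size_map.
  rewrite (@size_flatten_const _ _ _ _ (size Lk)); last first.
    by move=> z; rewrite size_map.
  rewrite (@size_flatten_const _ _ _ _ (size Lm)); last first.
    by move=> z; rewrite size_map.
  rewrite -!cardE !card_prod !card_ord size_map.
  have -> (a b c d x y : nat) : (x * a + (y * b + (k * c + d))) * 96 =
    x * (a * 96) + y * (b * 96) + k * (c * 96) + d * 96 by ring.
  rewrite Lksize Lk1size Lmsize Lusize.
  (* Writing [m] as [u + e] and splitting on [k] removes subtractions and predecessors before
     [ring]. *)
  have := subnKC um; move: (m - u) => e; rewrite /m => <-.
  by case: (k) => [|k'] /=; ring.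
have cov1 z x y : x.1 != y.1 ->
    dart_in (L1 ++ L2 ++ L3 ++ L4) (G1 z x) (G1 z y).
  move=> xy; apply/dart_in_catl/(@dart_in_flatten _ _ _ _ z).
    by rewrite mem_enum.
  exact/dart_in_map/Lk1cov.
have cov2 z x y : x.1 != y.1 ->
    dart_in (L1 ++ L2 ++ L3 ++ L4) (G2 z x) (G2 z y).
  move=> xy; apply/dart_in_catr/dart_in_catl/(@dart_in_flatten _ _ _ _ z).
    by rewrite mem_enum.
  exact/dart_in_map/Lkcov.
have cov3 j x y : x != y ->
    dart_in (L1 ++ L2 ++ L3 ++ L4) (G3 j x) (G3 j y).
  move=> xy; apply/dart_in_catr/dart_in_catr/dart_in_catl.
  apply/(@dart_in_flatten _ _ _ _ j); first by rewrite mem_enum.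
  exact/dart_in_map/Lmcov.
have cov4 x y : x != y -> dart_in (L1 ++ L2 ++ L3 ++ L4) (G4 x) (G4 y).
  by move=> xy; do 3!apply/dart_in_catr; apply/dart_in_map/Lucov.
have lineP (j : 'I_k) (y b : 'I_p.+2) :
    inl (j, y) = line (y - (j : nat)%:R * b)%R b j.
  by rewrite /line subrK.
have covline a b (i j : 'I_k) w w' : i != j ->
    dart_in (L1 ++ L2 ++ L3 ++ L4) (Some (line a b i, w)) (Some (line a b j, w')).
  move=> ij; case: (ltnP b u) => [bu|ub].
    have := cov1 (a, Ordinal bu) (Some i, w) (Some j, w') ij.
    by rewrite /G1 /= natr_Zp.
  have bm : b < m := ltn_ord b.
  have bmu : b - u < m - u by rewrite ltn_sub2r // (leq_ltn_trans ub).
  have := cov2 (a, Ordinal bmu) (i, w) (j, w') ij.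
  by rewrite /G2 /= subnKC // natr_Zp.
have covinf j y c w w' :
    dart_in (L1 ++ L2 ++ L3 ++ L4) (Some (inl (j, y), w)) (Some (inr c, w')) /\
    dart_in (L1 ++ L2 ++ L3 ++ L4) (Some (inr c, w')) (Some (inl (j, y), w)).
  pose a : 'I_p.+2 := (y - (j : nat)%:R * (c : nat)%:R)%R.
  rewrite (lineP j y (c : nat)%:R%R); split.
    exact: (cov1 (a, c) (Some j, w) (None, w')).
  exact: (cov1 (a, c) (None, w') (Some j, w)).
move=> [[[[i y]|c] w]|] [[[[j y']|c'] w']|] // xy.
- case: (eqVneq i j) => [ij|ij].
    rewrite -ij in xy *; apply: (cov3 i (Some (y, w)) (Some (y', w'))).
    by apply: contraNneq xy => -[-> ->].
  (* The slope of the line through the two points, as [j - i] is invertible. *)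
  pose b : 'I_p.+2 := ((y' - y) / ((j : nat)%:R - (i : nat)%:R))%R.
  have y'E : inl (j, y') = line (y - (i : nat)%:R * b)%R b j.
    rewrite /line; congr (inl (_, _)).
    rewrite -addrA -mulNr -mulrDl [(- _ + _)%R]addrC mulrC divrK ?natr_sub_unit //.
    by rewrite addrC subrK.
  by rewrite (lineP i y b) y'E; apply: covline.
- by case: (covinf i y c' w w').
- exact: (cov3 i (Some (y, w)) None).
- by case: (covinf j y' c w' w).
- apply: (cov4 (Some (c, w)) (Some (c', w'))).
  by apply: contraNneq xy => -[-> ->].
- exact: (cov4 (Some (c, w)) None).
- exact: (cov3 j None (Some (y', w'))).
- exact: (cov4 None (Some (c', w'))).
Qed.

End TruncatedTransversal.

(** * Small designs *)

Definition ord_pair (m s : nat) (x : nat * nat) : 'I_m.+1 * 'I_s.+1 :=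
  (inZp x.1, inZp x.2).

Definition ord_pair_pts (m s : nat) : seq ('I_m.+1 * 'I_s.+1) :=
  [seq (x, y) | x <- ord_pts m, y <- ord_pts s].

Lemma mem_ord_pair_pts m s (x : 'I_m.+1 * 'I_s.+1) : x \in ord_pair_pts m s.
Proof. by apply/allpairsP; exists x; rewrite !mem_ord_pts -surjective_pairing. Qed.

(** Makes a product of finite abelian groups a [finZmodType]. *)
HB.instance Definition _ (U V : finZmodType) := Finite.on (U * V)%type.

(* In [F_p] with [p = 97, 193] and in [F_289] the labels of the base blocks are
   equivariant under an automorphism of order 3 of the graph, which acts as a
   cube root of unity; the other base blocks are multiples of the first one. *)
Lemma complete_dec_97 : complete_dec 'I_97.
Proof.
pose B := [:: 0; 30; 37; 25; 84; 2; 56; 21; 26; 5; 34; 20; 70; 78; 14; 80].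
apply: (@complete_dec_difference_family _ (ord_pts 96) [:: [seq inZp x | x <- B]]).
- exact: mem_ord_pts.
- by vm_compute.
- by rewrite card_ord.
Qed.

Lemma complete_dec_193 : complete_dec 'I_193.
Proof.
pose B := [:: 0; 66; 18; 97; 180; 42; 159; 188; 14; 158; 161; 39; 54; 148; 80; 140].
(* The factor 81 is a square root of -1 modulo 193; the differences of a block are closed under
   negation. *)
apply: (@complete_dec_difference_family _ (ord_pts 192)
  [:: [seq inZp x | x <- B]; [seq inZp (81 * x) | x <- B]]).
- exact: mem_ord_pts.
- by vm_compute.
- by rewrite card_ord.
Qed.

Lemma complete_dec_289 : complete_dec ('I_17 * 'I_17)%type.
Proof.
pose B := [:: (0,0); (4,16); (12,10); (5,11); (10,2); (15,0); (4,13); (2,6);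
              (8,0); (13,12); (14,7); (11,15); (14,6); (13,16); (8,6); (3,16)].
(* With [(a, b)] read as a + bX, this is multiplication by a root X of X^2 - 7X + 1 over F_17, an
   element of order 9 whose cube is a cube root of unity. *)
pose M x := (16 * x.2, x.1 + 7 * x.2).
apply: (@complete_dec_difference_family _ (ord_pair_pts 16 16)
  [seq [seq ord_pair 16 16 (iter i M x) | x <- B] | i <- iota 0 3]).
- exact: mem_ord_pair_pts.
- by vm_compute.
- by rewrite card_prod !card_ord.
Qed.

(* [K_{4,4,4,4}] is [Cay(Z_4^2, Z_4^2 \ 2 Z_4^2)]; its connection set splits into
   that of the Shrikhande graph and its image under [(1, 0) |-> (1, 2)],
   [(0, 1) |-> (2, 3)].  The point [(a, b)] is coded as
   [(2 (a %% 2) + b %% 2, 2 (a %/ 2) + b %/ 2)]. *)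
Lemma multi_dec_4_4 : multi_dec 'I_4 'I_4.
Proof.
apply: (@multi_dec_check 3 3
    [:: [:: (0,0); (1,0); (0,1); (1,1); (2,0); (3,0); (2,1); (3,1); (0,2);
    (1,2); (0,3); (1,3); (2,2); (3,2); (2,3); (3,3)]; [:: (0,0); (1,3); (0,1);
    (1,2); (2,1); (3,2); (2,0); (3,3); (0,2); (1,1); (0,3); (1,0); (2,3);
    (3,0); (2,2); (3,1)]]); last by [].
by vm_compute.
Qed.

(* The translates of one block in [Cay(Z_8 * Z_4, Z_8 * Z_4 \ 2 Z_8 * 2 Z_4)]. *)
Lemma multi_dec_4_8 : multi_dec 'I_4 'I_8.
Proof.
apply: (@multi_dec_check 3 7
    [:: [:: (0,0); (1,0); (0,4); (1,4); (2,0); (3,3); (2,4); (3,7); (0,1);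
    (1,1); (0,5); (1,5); (2,1); (3,2); (2,5); (3,6)]; [:: (1,0); (0,1); (1,4);
    (0,5); (3,0); (2,2); (3,4); (2,6); (1,1); (0,0); (1,5); (0,4); (3,1);
    (2,3); (3,5); (2,7)]; [:: (2,0); (3,0); (2,4); (3,4); (0,2); (1,5); (0,6);
    (1,1); (2,1); (3,1); (2,5); (3,5); (0,3); (1,4); (0,7); (1,0)]; [:: (3,0);
    (2,1); (3,4); (2,5); (1,2); (0,4); (1,6); (0,0); (3,1); (2,0); (3,5);
    (2,4); (1,3); (0,5); (1,7); (0,1)]; [:: (0,2); (1,2); (0,6); (1,6); (2,2);
    (3,5); (2,6); (3,1); (0,3); (1,3); (0,7); (1,7); (2,3); (3,4); (2,7);
    (3,0)]; [:: (1,2); (0,3); (1,6); (0,7); (3,2); (2,4); (3,6); (2,0); (1,3);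
    (0,2); (1,7); (0,6); (3,3); (2,5); (3,7); (2,1)]; [:: (2,2); (3,2); (2,6);
    (3,6); (0,4); (1,7); (0,0); (1,3); (2,3); (3,3); (2,7); (3,7); (0,5);
    (1,6); (0,1); (1,2)]; [:: (3,2); (2,3); (3,6); (2,7); (1,4); (0,6); (1,0);
    (0,2); (3,3); (2,2); (3,7); (2,6); (1,5); (0,7); (1,1); (0,3)]]); last by [].
by vm_compute.
Qed.

(** The blocks are (i, j, i + j, i + 2j) over F_3. *)
Lemma gdd4_4_3 : gdd4 'I_4 'I_3.
Proof.
apply: (@transversal_gdd4 2
    [:: [:: 0; 0; 0; 0]; [:: 0; 1; 1; 2]; [:: 0; 2; 2; 1]; [:: 1; 0; 1; 1];
    [:: 1; 1; 2; 0]; [:: 1; 2; 0; 2]; [:: 2; 0; 2; 2]; [:: 2; 1; 0; 1]; [:: 2;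
    2; 1; 0]]); last by [].
by vm_compute.
Qed.

(** The blocks are (i, j, i + j, i + wj) over F_4 = {0, 1, w, w + 1}, coded as 0, 1, 2, 3. *)
Lemma gdd4_4_4 : gdd4 'I_4 'I_4.
Proof.
apply: (@transversal_gdd4 3
    [:: [:: 0; 0; 0; 0]; [:: 0; 1; 1; 2]; [:: 0; 2; 2; 3]; [:: 0; 3; 3; 1];
    [:: 1; 0; 1; 1]; [:: 1; 1; 0; 3]; [:: 1; 2; 3; 2]; [:: 1; 3; 2; 0]; [:: 2;
    0; 2; 2]; [:: 2; 1; 3; 0]; [:: 2; 2; 0; 1]; [:: 2; 3; 1; 3]; [:: 3; 0; 3;
    3]; [:: 3; 1; 2; 1]; [:: 3; 2; 1; 0]; [:: 3; 3; 0; 2]]); last by [].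
by vm_compute.
Qed.

Lemma multi_dec_4_16 : multi_dec 'I_4 'I_16.
Proof.
by apply: multi_dec_card (gdd4_multi_dec gdd4_4_4 multi_dec_4_4);
  rewrite // card_prod !card_ord.
Qed.

(** Two inflations starting from parts of size 8, as 96 = 3 * 4 * 8. *)
Lemma multi_dec_4_96 : multi_dec 'I_4 'I_96.
Proof.
apply: multi_dec_card (gdd4_multi_dec gdd4_4_3 (gdd4_multi_dec gdd4_4_4 multi_dec_4_8)) => //.
by rewrite !card_prod !card_ord.
Qed.

(** The base blocks [Q] over Z_(m+1) x Z_(s+1) give a 4-GDD; weight [w] turns its groups into parts
    of size 96. *)
Lemma multi_dec_of_quads m s w (Q : seq (seq (nat * nat))) :
  multi_dec 'I_4 'I_w -> s.+1 * w = 96 -> size Q * 12 = m * s.+1 ->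
  all_covered (fun d => d.1 == 0%R)
    (block_diffs 4 [seq [seq ord_pair m s x | x <- B] | B <- Q])
    (ord_pair_pts m s) ->
  multi_dec 'I_m.+1 'I_96.
Proof.
move=> multi_dec_w sw Qsize cov.
have gddQ : gdd4 'I_m.+1 'I_s.+1.
  apply: (gdd4_difference (@mem_ord_pair_pts m s) cov).
  by rewrite size_map !card_ord.
by apply: multi_dec_card (gdd4_multi_dec gddQ multi_dec_w);
  rewrite ?card_prod !card_ord.
Qed.

(** The triples [T] are those completed in the fixed group, which raises the number of parts to
    [m.+2]. *)
Lemma multi_dec_of_quads_infty m s w (Q T : seq (seq (nat * nat))) :
  multi_dec 'I_4 'I_w -> s.+1 * w = 96 -> (size Q + size T) * 12 = m.+2 * s.+1 ->
  all_covered (fun d => d.1 == 0%R)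
    (block_diffs 4 [seq [seq ord_pair m s x | x <- B] | B <- Q] ++
     block_diffs 3 [seq [seq ord_pair m s x | x <- B] | B <- T])
    (ord_pair_pts m s) ->
  all_covered pred0
    [seq (nth 0%R J a).2
       | J <- [seq [seq ord_pair m s x | x <- B] | B <- T], a <- iota 0 3]
    (ord_pts s) ->
  multi_dec 'I_m.+2 'I_96.
Proof.
move=> multi_dec_w sw Qsize cov infcov.
have gddQ : gdd4 (option 'I_m.+1) 'I_s.+1.
  apply: (gdd4_difference_infty (@mem_ord_pair_pts m s) (@mem_ord_pts s) cov infcov).
  by rewrite !size_map !card_ord.
by apply: multi_dec_card (gdd4_multi_dec gddQ multi_dec_w);
  rewrite ?card_prod ?card_option !card_ord.
Qed.

(** * Complete multipartite graphs with 5 to 19 parts of size 96 *)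

Lemma multi_dec_5_96 : multi_dec 'I_5 'I_96.
Proof.
apply: (@multi_dec_of_quads 4 23 4
    [:: [:: (0,0); (4,0); (3,12); (1,14)]; [:: (0,0); (4,23); (3,7); (1,20)];
    [:: (0,0); (4,22); (3,17); (2,4)]; [:: (0,0); (4,21); (2,5); (1,6)]; [::
    (0,0); (4,20); (3,11); (2,20)]; [:: (0,0); (4,17); (2,2); (3,23)]; [::
    (0,0); (4,16); (2,6); (1,11)]; [:: (0,0); (4,14); (1,22); (3,21)]]
    multi_dec_4_4) => [//|//|].
by vm_compute.
Qed.

Lemma multi_dec_6_96 : multi_dec 'I_6 'I_96.
Proof.
apply: (@multi_dec_of_quads_infty 4 23 4
    [:: [:: (0,0); (4,0); (2,6); (1,2)]; [:: (0,0); (4,23); (2,11); (3,2)];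
    [:: (0,0); (4,18); (3,11); (1,11)]; [:: (0,0); (4,15); (1,18); (2,7)]]
    [:: [:: (0,0); (4,2); (3,23)]; [:: (0,1); (4,6); (2,11)]; [:: (0,3);
    (3,7); (1,17)]; [:: (0,4); (2,9); (1,21)]; [:: (0,5); (4,19); (2,20)]; [::
    (0,8); (4,12); (1,16)]; [:: (0,10); (1,15); (4,18)]; [:: (0,13); (4,14);
    (2,22)]]
    multi_dec_4_4) => [//|//||].
- by vm_compute.
- by vm_compute.
Qed.

(** With groups of size 6 and weight 16, the block count forces an odd number of parts without a
    fixed group and an even number with one. *)
Lemma multi_dec_7_96 : multi_dec 'I_7 'I_96.
Proof.
apply: (@multi_dec_of_quads 6 5 16
    [:: [:: (0,0); (6,0); (2,4); (4,1)]; [:: (0,0); (6,5); (3,2); (2,0)]; [::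
    (0,0); (6,3); (1,4); (5,4)]]
    multi_dec_4_16) => [//|//|].
by vm_compute.
Qed.

Lemma multi_dec_8_96 : multi_dec 'I_8 'I_96.
Proof.
apply: (@multi_dec_of_quads_infty 6 23 4
    [:: [:: (0,0); (6,0); (4,19); (3,18)]; [:: (0,0); (6,22); (1,13); (2,22)];
    [:: (0,0); (6,21); (4,17); (3,1)]; [:: (0,0); (6,20); (5,21); (3,11)]; [::
    (0,0); (6,18); (2,11); (1,20)]; [:: (0,0); (6,16); (3,13); (1,12)]; [::
    (0,0); (6,6); (5,11); (3,2)]; [:: (0,0); (6,2); (2,14); (4,14)]]
    [:: [:: (0,0); (4,16); (3,23)]; [:: (0,1); (4,10); (5,17)]; [:: (0,2);
    (2,9); (6,12)]; [:: (0,3); (5,4); (3,22)]; [:: (0,5); (5,8); (6,19)]; [::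
    (0,6); (5,11); (4,14)]; [:: (0,7); (5,15); (3,21)]; [:: (0,13); (1,18);
    (5,20)]]
    multi_dec_4_4) => [//|//||].
- by vm_compute.
- by vm_compute.
Qed.

Lemma multi_dec_9_96 : multi_dec 'I_9 'I_96.
Proof.
apply: (@multi_dec_of_quads 8 5 16
    [:: [:: (0,0); (8,0); (5,4); (1,5)]; [:: (0,0); (8,5); (7,2); (5,2)]; [::
    (0,0); (8,4); (3,4); (5,5)]; [:: (0,0); (8,2); (6,5); (2,2)]]
    multi_dec_4_16) => [//|//|].
by vm_compute.
Qed.

Lemma multi_dec_10_96 : multi_dec 'I_10 'I_96.
Proof.
apply: (@multi_dec_of_quads_infty 8 5 16
    [:: [:: (0,0); (8,0); (3,0); (2,2)]; [:: (0,0); (8,5); (3,4); (1,5)]; [::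
    (0,0); (8,4); (2,3); (4,1)]]
    [:: [:: (0,0); (4,2); (6,3)]; [:: (0,1); (1,4); (4,5)]]
    multi_dec_4_16) => [//|//||].
- by vm_compute.
- by vm_compute.
Qed.

Lemma multi_dec_11_96 : multi_dec 'I_11 'I_96.
Proof.
apply: (@multi_dec_of_quads 10 5 16
    [:: [:: (0,0); (10,0); (4,1); (1,5)]; [:: (0,0); (10,5); (2,4); (6,3)];
    [:: (0,0); (10,4); (2,1); (6,4)]; [:: (0,0); (10,3); (5,4); (3,1)]; [::
    (0,0); (10,2); (2,0); (8,0)]]
    multi_dec_4_16) => [//|//|].
by vm_compute.
Qed.

Lemma multi_dec_12_96 : multi_dec 'I_12 'I_96.
Proof.
apply: (@multi_dec_of_quads_infty 10 5 16
    [:: [:: (0,0); (10,0); (5,5); (1,5)]; [:: (0,0); (10,5); (6,3); (7,5)];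
    [:: (0,0); (10,2); (8,2); (2,4)]; [:: (0,0); (9,5); (2,2); (4,5)]]
    [:: [:: (0,0); (6,2); (3,5)]; [:: (0,1); (7,3); (10,4)]]
    multi_dec_4_16) => [//|//||].
- by vm_compute.
- by vm_compute.
Qed.

Lemma multi_dec_13_96 : multi_dec 'I_13 'I_96.
Proof.
apply: (@multi_dec_of_quads 12 5 16
    [:: [:: (0,0); (12,0); (7,4); (5,0)]; [:: (0,0); (12,5); (7,1); (8,3)];
    [:: (0,0); (12,3); (9,0); (2,1)]; [:: (0,0); (12,2); (3,1); (2,2)]; [::
    (0,0); (11,0); (3,5); (9,3)]; [:: (0,0); (11,1); (8,5); (4,4)]]
    multi_dec_4_16) => [//|//|].
by vm_compute.
Qed.

Lemma multi_dec_14_96 : multi_dec 'I_14 'I_96.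
Proof.
apply: (@multi_dec_of_quads_infty 12 5 16
    [:: [:: (0,0); (12,0); (8,2); (2,4)]; [:: (0,0); (12,5); (7,3); (5,0)];
    [:: (0,0); (12,4); (2,0); (4,1)]; [:: (0,0); (12,3); (10,1); (4,2)]; [::
    (0,0); (12,1); (9,1); (5,1)]]
    [:: [:: (0,0); (11,1); (10,3)]; [:: (0,2); (6,4); (9,5)]]
    multi_dec_4_16) => [//|//||].
- by vm_compute.
- by vm_compute.
Qed.

Lemma multi_dec_15_96 : multi_dec 'I_15 'I_96.
Proof.
apply: (@multi_dec_of_quads 14 5 16
    [:: [:: (0,0); (14,0); (2,5); (3,0)]; [:: (0,0); (14,4); (3,2); (5,0)];
    [:: (0,0); (14,3); (9,2); (8,4)]; [:: (0,0); (14,1); (4,3); (7,4)]; [::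
    (0,0); (13,0); (6,0); (11,5)]; [:: (0,0); (13,4); (11,1); (6,3)]; [::
    (0,0); (12,3); (9,5); (4,2)]]
    multi_dec_4_16) => [//|//|].
by vm_compute.
Qed.

Lemma multi_dec_16_96 : multi_dec 'I_16 'I_96.
Proof.
apply: (@multi_dec_of_quads_infty 14 5 16
    [:: [:: (0,0); (14,0); (11,3); (8,3)]; [:: (0,0); (14,4); (2,0); (9,4)];
    [:: (0,0); (14,3); (10,4); (9,0)]; [:: (0,0); (14,1); (5,5); (7,0)]; [::
    (0,0); (13,4); (7,5); (11,0)]; [:: (0,0); (13,3); (7,2); (3,4)]]
    [:: [:: (0,0); (11,4); (12,5)]; [:: (0,1); (12,2); (10,3)]]
    multi_dec_4_16) => [//|//||].
- by vm_compute.
- by vm_compute.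
Qed.

Lemma multi_dec_17_96 : multi_dec 'I_17 'I_96.
Proof.
apply: (@multi_dec_of_quads 16 5 16
    [:: [:: (0,0); (16,0); (11,1); (2,1)]; [:: (0,0); (16,5); (3,5); (11,4)];
    [:: (0,0); (16,4); (10,0); (7,2)]; [:: (0,0); (16,3); (13,1); (1,5)]; [::
    (0,0); (16,2); (4,2); (11,5)]; [:: (0,0); (15,0); (4,3); (13,2)]; [::
    (0,0); (15,3); (5,2); (8,2)]; [:: (0,0); (15,1); (7,4); (4,1)]]
    multi_dec_4_16) => [//|//|].
by vm_compute.
Qed.

Lemma multi_dec_18_96 : multi_dec 'I_18 'I_96.
Proof.
apply: (@multi_dec_of_quads_infty 16 5 16
    [:: [:: (0,0); (16,0); (3,4); (9,0)]; [:: (0,0); (16,5); (13,4); (2,5)];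
    [:: (0,0); (16,4); (4,3); (2,0)]; [:: (0,0); (16,2); (6,3); (12,2)]; [::
    (0,0); (16,1); (9,4); (7,2)]; [:: (0,0); (15,2); (10,1); (6,0)]; [::
    (0,0); (14,3); (5,0); (8,5)]]
    [:: [:: (0,0); (2,1); (7,4)]; [:: (0,2); (13,3); (1,5)]]
    multi_dec_4_16) => [//|//||].
- by vm_compute.
- by vm_compute.
Qed.

Lemma multi_dec_19_96 : multi_dec 'I_19 'I_96.
Proof.
apply: (@multi_dec_of_quads 18 5 16
    [:: [:: (0,0); (18,0); (11,2); (9,1)]; [:: (0,0); (18,5); (3,3); (17,2)];
    [:: (0,0); (18,4); (15,3); (11,1)]; [:: (0,0); (18,2); (4,5); (11,0)]; [::
    (0,0); (18,1); (6,1); (16,1)]; [:: (0,0); (17,4); (14,4); (4,1)]; [::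
    (0,0); (17,3); (14,1); (6,0)]; [:: (0,0); (17,1); (10,2); (4,0)]; [::
    (0,0); (16,2); (11,4); (6,4)]]
    multi_dec_4_16) => [//|//|].
by vm_compute.
Qed.

(** * Recursion *)

Definition complete_dec96 (t : nat) : Prop := complete_dec (option ('I_t * 'I_96)).

Lemma complete_dec96_of_card t (V : finType) : complete_dec V -> #|V| = (t * 96).+1 -> complete_dec96 t.
Proof.
by move=> desV cardV; apply: complete_dec_card desV; rewrite cardV card_option card_prod !card_ord.
Qed.

(** The one-point design, which also fills the last group when it is truncated to nothing. *)
Lemma complete_dec96_0 : complete_dec96 0.
Proof.
exists [::]; last by rewrite card_option card_prod card_ord.
by move=> [[[]//]|] [[[]//]|].
Qed.

Lemma complete_dec96_of_multi_dec t : multi_dec 'I_t 'I_96 -> complete_dec96 t.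
Proof.
move=> multi_dec_t; apply: (multi_dec_complete_dec multi_dec_t).
by apply: complete_dec_card complete_dec_97; rewrite card_option !card_ord.
Qed.

Lemma complete_dec96_small t : t < 20 -> complete_dec96 t.
Proof.
case: t => [_|t]; first exact: complete_dec96_0.
case: t => [_|t]; first by apply: complete_dec96_of_card complete_dec_97 _; rewrite card_ord.
case: t => [_|t]; first by apply: complete_dec96_of_card complete_dec_193 _; rewrite card_ord.
case: t => [_|t]; first by apply: complete_dec96_of_card complete_dec_289 _; rewrite card_prod !card_ord.
case: t => [_|t]; first exact: complete_dec96_of_multi_dec multi_dec_4_96.
case: t => [_|t]; first exact: complete_dec96_of_multi_dec multi_dec_5_96.
case: t => [_|t]; first exact: complete_dec96_of_multi_dec multi_dec_6_96.
case: t => [_|t]; first exact: complete_dec96_of_multi_dec multi_dec_7_96.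
case: t => [_|t]; first exact: complete_dec96_of_multi_dec multi_dec_8_96.
case: t => [_|t]; first exact: complete_dec96_of_multi_dec multi_dec_9_96.
case: t => [_|t]; first exact: complete_dec96_of_multi_dec multi_dec_10_96.
case: t => [_|t]; first exact: complete_dec96_of_multi_dec multi_dec_11_96.
case: t => [_|t]; first exact: complete_dec96_of_multi_dec multi_dec_12_96.
case: t => [_|t]; first exact: complete_dec96_of_multi_dec multi_dec_13_96.
case: t => [_|t]; first exact: complete_dec96_of_multi_dec multi_dec_14_96.
case: t => [_|t]; first exact: complete_dec96_of_multi_dec multi_dec_15_96.
case: t => [_|t]; first exact: complete_dec96_of_multi_dec multi_dec_16_96.
case: t => [_|t]; first exact: complete_dec96_of_multi_dec multi_dec_17_96.
case: t => [_|t]; first exact: complete_dec96_of_multi_dec multi_dec_18_96.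
case: t => [_|t]; first exact: complete_dec96_of_multi_dec multi_dec_19_96.
by [].
Qed.

Lemma complete_dec96_step k m u : 1 < m -> u <= m ->
  (forall i, 0 < i < k -> coprime m i) ->
  multi_dec 'I_k 'I_96 -> multi_dec 'I_k.+1 'I_96 -> complete_dec96 m -> complete_dec96 u -> complete_dec96 (k * m + u).
Proof.
case: m => [|[|p]] // _ um co_m multi_dec_k multi_dec_k1 complete_dec_m complete_dec_u.
have multi_dec_ok : multi_dec (option 'I_k) 'I_96.
  by apply: multi_dec_card multi_dec_k1; rewrite ?card_option !card_ord.
apply: complete_dec96_of_card (truncated_transversal_complete_dec co_m um multi_dec_k multi_dec_ok complete_dec_m complete_dec_u) _.
by rewrite card_option card_prod card_sum card_prod !card_ord.
Qed.

Lemma coprime_lt5 m i : odd m -> ~~ (3 %| m) -> 0 < i < 5 -> coprime m i.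
Proof.
move=> m2 m3; case: i => [|[|[|[|[|i]]]]] // _; rewrite ?coprimen1 //.
- by rewrite coprime_sym prime_coprime // dvdn2 m2.
- by rewrite coprime_sym prime_coprime.
- by rewrite -[4]/(2 ^ 2) coprimeXr // coprime_sym prime_coprime // dvdn2 m2.
Qed.

Lemma complete_dec96_all t : complete_dec96 t.
Proof.
elim/ltn_ind: t => t IHt; have [t20|t20] := ltnP t 20; first exact: complete_dec96_small.
(* Such an [m] is prime to 1, 2, 3 and 4, so [k = 4] and [k = 5] are both available; with remainders
   up to [m] they reach from [4 * m] to [6 * m]. *)
have step m : odd m -> ~~ (3 %| m) -> 1 < m -> 4 * m <= t <= 6 * m -> complete_dec96 t.
  move=> m2 m3 m1 /andP[mt tm]; have [t5|t5] := ltnP t (5 * m).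
    rewrite -(subnKC mt); apply: complete_dec96_step; try lia.
    - by move=> i /andP[i0 i4]; apply: coprime_lt5; rewrite // i0 ltnW.
    - exact: multi_dec_4_96.
    - exact: multi_dec_5_96.
    - by apply: IHt; lia.
    - by apply: IHt; lia.
  rewrite -(subnKC t5); apply: complete_dec96_step; try lia.
  - by move=> i; apply: coprime_lt5.
  - exact: multi_dec_5_96.
  - exact: multi_dec_6_96.
  - by apply: IHt; lia.
  - by apply: IHt; lia.
(* Only 8, 9 and 10 satisfy 4m <= 43 <= 6m, and none is prime to 6; hence [k = 6] with [m = 7]. *)
have [t43|t43] := eqVneq t 43.
  rewrite t43 -[43]/(6 * 7 + 1); apply: complete_dec96_step => //.
  - by case=> [|[|[|[|[|[|i]]]]]].
  - exact: multi_dec_6_96.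
  - exact: multi_dec_7_96.
  - exact: complete_dec96_small.
  - exact: complete_dec96_small.
have [/andP[t31 t42]|t31] := boolP (31 <= t <= 42); first by apply: (step 7); lia.
have [t67|t67] := eqVneq t 67; first by apply: (step 13); lia.
(* This [m] is prime to 6 and satisfies 4m <= t <= 4m + 23, which is at most 6m once m >= 12. For m
   = 5 and m = 11 the values left over, 31 to 43 and 67, are settled above. *)
by apply: (step (6 * ((t - 20) %/ 24) + 5)); lia.
Qed.

Theorem theorem2p1 (n : nat) : (0 < n)%N ->
  (shr_design n <-> n = 1 %[mod 96]).
Proof.
move=> n0; split; first exact: shr_design_necessary.
move=> n1; have := complete_dec_shr_design (complete_dec96_all (n %/ 96)).
rewrite card_option card_prod !card_ord.
by have -> : (n %/ 96 * 96).+1 = n by lia.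
Qed.
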